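(* Let $n,m\ge1$ be integers and let $S,T\in B(\mathcal H)$ with $S,T\in[(n,m)DN]$, where $S$ has Drazin index $q$ and $T$ has Drazin index $p$. Let $C\in B(\mathcal H)$, regarded as an operator $C:S^q(\mathcal H)\oplus S^{-q}(0)\to T^p(\mathcal H)\oplus T^{-p}(0)$, have the direct sum decomposition $C=0\oplus C_{22}$ (i.e. $C$ vanishes on $S^q(\mathcal H)$ and maps $S^{-q}(0)$ into $T^{-p}(0)$). Then the operator $$A=\begin{pmatrix}T&C\\0&S\end{pmatrix}\in B(\mathcal H\oplus\mathcal H)$$ satisfies $A\in[(n,m)DN]$.
   Context: $\mathcal H$ is a complex infinite dimensional Hilbert space and $B(\mathcal H)$ is the algebra of bounded linear operators on $\mathcal H$; $[X,Y]=XY-YX$ and $T^{*m}=(T^* )^m$. An operator $T$ on a Hilbert space is Drazin invertible if there is a bounded operator $T_d$ (the Drazin inverse) with $[T_d,T]=0$, $T_d^2T=T_d$ and $T^{p+1}T_d=T^p$ for some integer $p\ge1$; the (least such) $p$ is the Drazin index of $T$ (if $T$ is invertible, $T_d=T^{-1}$). For positive integers $n,m$, $T\in[(n,m)DN]$ means that $T$ is Drazin invertible and $[T_d^n,T^{*m}]=0$. $T^{-p}(0)$ denotes the kernel of $T^p$ and $T^p(\mathcal H)$ the range of $T^p$; for $T$ of Drazin index $p$, $\mathcal H=T^p(\mathcal H)\oplus T^{-p}(0)$. *)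

(* Defs.v *)
From HB Require Import structures.
From mathcomp Require Import all_boot all_order all_algebra sesquilinear.
From mathcomp Require Import complex ring lra.
From mathcomp Require Import boolp classical_sets reals topology normedtype.

Set Implicit Arguments.
Unset Strict Implicit.
Unset Printing Implicit Defensive.

Import Order.TTheory GRing.Theory Num.Theory.
Import numFieldNormedType.Exports.

Local Open Scope classical_set_scope.
Local Open Scope ring_scope.

(* The inner product is linear in its first argument and conjugate-linear in
   the second one. *)
HB.mixin Record hasInner (R : realType) H & CompleteNormedModule R[i] H := {
  inner : {dot H for Num.conj};
  norm_inner : forall x : H, `|x| ^+ 2 = inner x x
}.

#[short(type="hilbertType")]
HB.structure Definition Hilbert (R : realType) :=
  {H of CompleteNormedModule R[i] H & hasInner R H}.

Section InnerTheory.
Context (R : realType) (H : hilbertType R).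
Implicit Types x y z : H.

Lemma innerC x y : inner x y = Num.conj (inner y x).
Proof. by rewrite [LHS]hermC expr0 mul1r. Qed.

Lemma inner_norm_le x y : `|inner x y| <= `|x| * `|y|.
Proof.
have [->|y0] := eqVneq y 0; first by rewrite linear0r !normr0 mulr0.
have by0 : 0 < inner y y by rewrite dnorm_gt0.
set b := inner y y in by0 *; set c := inner x y.
rewrite -ler_sqr ?nnegrE ?mulr_ge0// exprMn !norm_inner -/b normCK.
pose w := b *: x - c *: y.
have wy : inner w y = 0.
  by rewrite /w linearBl/= !linearZl_LR/= -/b -/c mulrC subrr.
have : 0 <= inner w w by exact: dnorm_ge0.
rewrite {2}/w linearBr/= !linearZr_LR/= wy mulr0 subr0.
rewrite /w linearBl/= !linearZl_LR/= (innerC y x) -/c.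
by rewrite (CrealP (gtr0_real by0)) pmulr_rge0// subr_ge0 (mulrC b).
Qed.

Lemma inner_inj x y : (forall z, inner z x = inner z y) -> x = y.
Proof.
move=> xy; apply/eqP; rewrite -subr_eq0 -(dnorm_eq0 (@inner R H)).
by rewrite linearBr/= xy subrr.
Qed.

Lemma parallelogram x y :
  `|x + y| ^+ 2 + `|x - y| ^+ 2 = 2 * (`|x| ^+ 2 + `|y| ^+ 2).
Proof.
rewrite !norm_inner linearDl/= linearBl/= !linearDr/= !linearNr/=.
set a := inner x x; set b := inner x y; set c := inner y x; set d := inner y y.
ring.
Qed.

End InnerTheory.

Record bop (R : realType) (H K : hilbertType R) := Bop {
  bop_fun :> H -> K;
  bop_linear : linear bop_fun;
  bop_bounded : exists M : R[i], forall x, `|bop_fun x| <= M * `|x|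
}.

Section BopInstances.
Context (R : realType) (H K : hilbertType R).

HB.instance Definition _ := gen_eqMixin (bop H K).
HB.instance Definition _ := gen_choiceMixin (bop H K).

HB.instance Definition _ (T : bop H K) :=
  GRing.isLinear.Build R[i] H K _ (T : H -> K) (@bop_linear R H K T).

Lemma bop_ext (S T : bop H K) : (forall x, S x = T x) -> S = T.
Proof.
case: S T => [f fl fb] [g gl gb] /= fg.
have {}fg : f = g by exact/funext.
by subst g; congr Bop; exact: Prop_irrelevance.
Qed.

Lemma bop_boundW (f : H -> K) (M : R[i]) :
  (forall x, `|f x| <= M * `|x|) -> forall x, `|f x| <= `|M| * `|x|.
Proof.
move=> fM x; have [->|x0] := eqVneq x 0.
  by have := fM 0; rewrite !normr0 !mulr0.
have Mx : 0 <= M * `|x| by apply: le_trans (fM x).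
have : 0 <= M by rewrite pmulr_lge0// ?normr_gt0 in Mx.
by move=> M0; rewrite (ger0_norm M0).
Qed.

Lemma bop_ge0_bounded (T : bop H K) :
  exists2 M : R[i], 0 <= M & forall x, `|T x| <= M * `|x|.
Proof.
by have [M /bop_boundW TM] := bop_bounded T; exists `|M|.
Qed.

Lemma bop0_bounded :
  exists M : R[i], forall x : H, `|(0 : K)| <= M * `|x|.
Proof. by exists 0 => x; rewrite mul0r normr0. Qed.

Lemma bop0_linear : linear (fun _ : H => 0 : K).
Proof. by move=> a x y; rewrite scaler0 addr0. Qed.

Definition bop0 := Bop bop0_linear bop0_bounded.

Lemma bopN_linear (T : bop H K) : linear (fun x => - T x).
Proof. by move=> a x y; rewrite linearP opprD scalerN. Qed.

Lemma bopN_bounded (T : bop H K) :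
  exists M : R[i], forall x, `|- T x| <= M * `|x|.
Proof. by have [M TM] := bop_bounded T; exists M => x; rewrite normrN. Qed.

Definition bopN T := Bop (bopN_linear T) (bopN_bounded T).

Lemma bopD_linear (S T : bop H K) : linear (fun x => S x + T x).
Proof. by move=> a x y; rewrite !linearP scalerDr addrACA. Qed.

Lemma bopD_bounded (S T : bop H K) :
  exists M : R[i], forall x, `|S x + T x| <= M * `|x|.
Proof.
have [[M SM] [N TN]] := (bop_bounded S, bop_bounded T); exists (M + N) => x.
by rewrite mulrDl (le_trans (ler_normD _ _))// lerD.
Qed.

Definition bopD S T := Bop (bopD_linear S T) (bopD_bounded S T).

Lemma bopDA : associative bopD.
Proof. by move=> S T U; apply: bop_ext => x /=; rewrite addrA. Qed.
Lemma bopDC : commutative bopD.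
Proof. by move=> S T; apply: bop_ext => x /=; rewrite addrC. Qed.
Lemma bop0D : left_id bop0 bopD.
Proof. by move=> S; apply: bop_ext => x /=; rewrite add0r. Qed.
Lemma bopND : left_inverse bop0 bopN bopD.
Proof. by move=> S; apply: bop_ext => x /=; rewrite addNr. Qed.

HB.instance Definition _ :=
  GRing.isZmodule.Build (bop H K) bopDA bopDC bop0D bopND.

End BopInstances.

Section BopComp.
Context (R : realType) (H K L : hilbertType R).

Lemma bop_comp_linear (S : bop K L) (T : bop H K) : linear (S \o T).
Proof. by move=> a x y; rewrite /= !linearP. Qed.

Lemma bop_comp_bounded (S : bop K L) (T : bop H K) :
  exists M : R[i], forall x, `|(S \o T) x| <= M * `|x|.
Proof.
have [M M0 SM] := bop_ge0_bounded S; have [N TN] := bop_bounded T.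
by exists (M * N) => x; rewrite (le_trans (SM _))// -mulrA ler_wpM2l.
Qed.

Definition bop_comp S T := Bop (bop_comp_linear S T) (bop_comp_bounded S T).

End BopComp.

Section BopRing.
Context (R : realType) (H : hilbertType R).

Lemma bop1_linear : linear (@idfun H).
Proof. by []. Qed.

Lemma bop1_bounded : exists M : R[i], forall x : H, `|x| <= M * `|x|.
Proof. by exists 1 => x; rewrite mul1r. Qed.

Definition bop1 : bop H H := Bop bop1_linear bop1_bounded.

Local Notation mul := (@bop_comp R H H H).

Lemma bopMA : associative mul.
Proof. by move=> S T U; exact: bop_ext. Qed.
Lemma bop1M : left_id bop1 mul.
Proof. by move=> S; exact: bop_ext. Qed.
Lemma bopM1 : right_id bop1 mul.
Proof. by move=> S; exact: bop_ext. Qed.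
Lemma bopMDl : left_distributive mul +%R.
Proof. by move=> S T U; exact: bop_ext. Qed.
Lemma bopMDr : right_distributive mul +%R.
Proof. by move=> S T U; apply: bop_ext => x /=; rewrite linearD. Qed.

HB.instance Definition _ := GRing.Zmodule_isPzRing.Build (bop H H)
  bopMA bop1M bopM1 bopMDl bopMDr.

End BopRing.

Section DirectSum.
Context (R : realType) (H K : hilbertType R).

(* The library's norm on H * K is the maximum norm, so the Hilbert space
   direct sum is built on a copy of H * K. *)
Definition hsum : Type := (H * K)%type.

HB.instance Definition _ := GRing.Lmodule.copy hsum (H * K)%type.

Definition hsum_norm (z : hsum) : R[i] := sqrtC (`|z.1| ^+ 2 + `|z.2| ^+ 2).

Lemma hsum_norm_ge0 z : 0 <= hsum_norm z.
Proof. by rewrite sqrtC_ge0 addr_ge0 ?exprn_ge0. Qed.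

Lemma hsum_normK z : hsum_norm z ^+ 2 = `|z.1| ^+ 2 + `|z.2| ^+ 2.
Proof. exact: sqrtCK. Qed.

Lemma hsum_norm_le1 z : `|z.1| <= hsum_norm z.
Proof.
by rewrite -ler_sqr ?nnegrE ?hsum_norm_ge0// hsum_normK lerDl exprn_ge0.
Qed.

Lemma hsum_norm_le2 z : `|z.2| <= hsum_norm z.
Proof.
by rewrite -ler_sqr ?nnegrE ?hsum_norm_ge0// hsum_normK lerDr exprn_ge0.
Qed.

Lemma hsum_norm_le z : hsum_norm z <= `|z.1| + `|z.2|.
Proof.
rewrite -ler_sqr ?nnegrE ?hsum_norm_ge0 ?addr_ge0// hsum_normK sqrrD.
by rewrite addrAC lerDl mulrn_wge0// mulr_ge0.
Qed.

Lemma hsum_ler_normD (z w : hsum) :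
  hsum_norm (z + w) <= hsum_norm z + hsum_norm w.
Proof.
have /= zw := (hsum_norm_ge0 z, hsum_norm_ge0 w, hsum_norm_ge0 (z + w)).
rewrite -ler_sqr ?nnegrE ?addr_ge0 ?zw// hsum_normK.
have le1 : `|z.1 + w.1| ^+ 2 <= (`|z.1| + `|w.1|) ^+ 2.
  by rewrite ler_sqr ?nnegrE ?addr_ge0// ler_normD.
have le2 : `|z.2 + w.2| ^+ 2 <= (`|z.2| + `|w.2|) ^+ 2.
  by rewrite ler_sqr ?nnegrE ?addr_ge0// ler_normD.
apply: le_trans (lerD le1 le2) _.
rewrite sqrrD [leRHS]sqrrD !hsum_normK sqrrD.
set a := `|z.1|; set b := `|z.2|; set c := `|w.1|; set d := `|w.2|.
set N := hsum_norm z; set M := hsum_norm w.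
have -> : a ^+ 2 + a * c *+ 2 + c ^+ 2 + (b ^+ 2 + b * d *+ 2 + d ^+ 2) =
          a ^+ 2 + b ^+ 2 + (a * c + b * d) *+ 2 + (c ^+ 2 + d ^+ 2).
  by rewrite mulrnDl addrACA; congr (_ + _); rewrite addrACA.
rewrite lerD2r lerD2l lerMn2r/=.
rewrite -ler_sqr ?nnegrE ?addr_ge0 ?mulr_ge0 ?zw//.
rewrite exprMn !hsum_normK -/a -/b -/c -/d -subr_ge0.
have -> : (a ^+ 2 + b ^+ 2) * (c ^+ 2 + d ^+ 2) - (a * c + b * d) ^+ 2 =
          (a * d - b * c) ^+ 2.
  ring.
by rewrite real_exprn_even_ge0// rpredB// rpredM// normr_real.
all: exact: normr_ge0.
Qed.

Lemma hsum_normZ (l : R[i]) (z : hsum) : hsum_norm (l *: z) = `|l| * hsum_norm z.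
Proof.
apply/eqP; rewrite -(eqrXn2 (n := 2)) ?mulr_ge0 ?hsum_norm_ge0//.
by rewrite exprMn !hsum_normK !normrZ !exprMn mulrDr.
Qed.

Lemma hsum_norm0_eq0 (z : hsum) : hsum_norm z = 0 -> z = 0.
Proof.
move=> z0; have := hsum_norm_le1 z; have := hsum_norm_le2 z; rewrite z0.
by rewrite !normr_le0; case: z {z0} => x y /= /eqP -> /eqP ->.
Qed.

HB.instance Definition _ := Lmodule_isNormed.Build R[i] hsum
  hsum_ler_normD hsum_normZ hsum_norm0_eq0.

Lemma hsum_normE (z : hsum) : `|z| = hsum_norm z.
Proof. by []. Qed.

Lemma hsum_complete (F : set_system hsum) :
  ProperFilter F -> cauchy F -> cvg F.
Proof.
move=> FF Fc.
have c1 : cauchy ((fun z : hsum => z.1) @ F).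
  apply/cauchy_exP => e e0; have /cauchyP/(_ e e0) [z Fz] := Fc.
  exists z.1; move: Fz; rewrite -!ball_normE /=; apply: filterS => w /=.
  by apply: le_lt_trans; exact: hsum_norm_le1 (z - w).
have c2 : cauchy ((fun z : hsum => z.2) @ F).
  apply/cauchy_exP => e e0; have /cauchyP/(_ e e0) [z Fz] := Fc.
  exists z.2; move: Fz; rewrite -!ball_normE /=; apply: filterS => w /=.
  by apply: le_lt_trans; exact: hsum_norm_le2 (z - w).
have /cvg_ex[x Fx] : cvg ((fun z : hsum => z.1) @ F) by exact: cauchy_cvg.
have /cvg_ex[y Fy] : cvg ((fun z : hsum => z.2) @ F) by exact: cauchy_cvg.
apply/cvg_ex; exists ((x, y) : hsum).
apply/cvgrPdist_lt => e e0.
have e20 : 0 < e / 2 by rewrite divr_gt0.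
move/cvgrPdist_lt : Fx => /(_ _ e20) Fx.
move/cvgrPdist_lt : Fy => /(_ _ e20) Fy.
near=> z; rewrite (le_lt_trans (hsum_norm_le _))//= (splitr e) ltrD//.
- by near: z.
- by near: z.
Unshelve. all: by end_near. Qed.

HB.instance Definition _ := Uniform_isComplete.Build hsum hsum_complete.

Definition hsum_inner (z w : hsum) : R[i] :=
  inner z.1 w.1 + inner z.2 w.2.

Lemma hsum_inner_bilinear :
  bilinear_for ( *%R ) (Num.conj \; *%R) hsum_inner.
Proof.
split=> [w a x y|z a x y]; rewrite /hsum_inner/=.
  by rewrite !linearPl/= mulrDr addrACA.
by rewrite !linearPr/= mulrDr addrACA.
Qed.

HB.instance Definition _ := bilinear_isBilinear.Build R[i] hsum hsum R[i]
  ( *%R ) (Num.conj \; *%R) hsum_inner hsum_inner_bilinear.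

Lemma hsum_inner_hermitian (z w : hsum) :
  hsum_inner z w = (-1) ^+ false * Num.conj (hsum_inner w z).
Proof. by rewrite expr0 mul1r rmorphD/= -!innerC. Qed.

HB.instance Definition _ := isHermitianSesquilinear.Build R[i] hsum
  false Num.conj hsum_inner hsum_inner_hermitian.

Lemma hsum_norm_inner (z : hsum) : `|z| ^+ 2 = hsum_inner z z.
Proof. by rewrite hsum_normE hsum_normK !norm_inner. Qed.

Lemma hsum_inner_gt0 (z : hsum) : z != 0 -> 0 < hsum_inner z z.
Proof. by move=> z0; rewrite -hsum_norm_inner exprn_gt0// normr_gt0. Qed.

HB.instance Definition _ := isDotProduct.Build R[i] hsum hsum_inner
  hsum_inner_gt0.

HB.instance Definition _ := hasInner.Build R hsum hsum_norm_inner.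

End DirectSum.

Section Riesz.
Context (R : realType) (H : hilbertType R).

Let nsq (x : H) : R := complex.Re (`|x| ^+ 2).

Let nsqE x : (nsq x)%:C%C = `|x| ^+ 2.
Proof. by rewrite RRe_real// ger0_real// exprn_ge0. Qed.

Let nsq_ge0 x : 0 <= nsq x.
Proof. by rewrite -lecR nsqE exprn_ge0. Qed.

Lemma riesz_representation (f : H -> R[i]) (M : R[i]) :
  scalar f -> (forall x, `|f x| <= M * `|x|) ->
  exists y, forall x, f x = inner x y.
Proof.
move=> flin fM.
pose fL : {scalar H} := HB.pack f (GRing.isLinear.Build R[i] H R[i] _ f flin).
have f00 : f 0 = 0 by exact: (linear0 fL).
have fB x y : f (x - y) = f x - f y by exact: (linearB fL).
have fD x y : f (x + y) = f x + f y by exact: (linearD fL).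
have fZ a x : f (a *: x) = a * f x by exact: (linearZ_LR fL).
have [f0|/existsNP[x0 /eqP fx0]] := pselect (forall x, f x = 0).
  by exists 0 => x; rewrite f0 linear0r.
pose A : set H := [set x | f x = 1].
have Ax0 : A ((f x0)^-1 *: x0) by rewrite /A/= fZ mulVf.
pose d := inf (nsq @` A).
have Ainf : has_inf (nsq @` A).
  split; first by exists (nsq ((f x0)^-1 *: x0)); exists ((f x0)^-1 *: x0).
  by exists 0 => _ [x _ <-].
have dA x : A x -> d <= nsq x.
  by move=> Ax; apply: ge_inf; [exact: Ainf.2|exists x].
pose B (e : R) : set H := [set x | A x /\ nsq x < d + e].
have Bcv e x y : B e x -> B e y -> nsq (x - y) <= 4 * e.
  move=> [Ax xe] [Ay ye].
  have Am : A (2^-1 *: (x + y)).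
    by rewrite /A/= fZ fD Ax Ay -[1 + 1]/(2%:R) mulVf// pnatr_eq0.
  have := dA _ Am.
  have pl : nsq (x + y) + nsq (x - y) = 2 * (nsq x + nsq y).
    apply/(@complexI R); rewrite rmorphM rmorph_nat !rmorphD/= !nsqE.
    exact: parallelogram.
  have -> : nsq (2^-1 *: (x + y)) = 4^-1 * nsq (x + y).
    apply/(@complexI R); rewrite rmorphM/= !nsqE normrZ exprMn fmorphV rmorph_nat.
    by rewrite normfV normr_nat exprVn -natrX.
  move=> h; lra.
pose F := filter_from [set e : R | 0 < e] B.
have FF : ProperFilter F.
  apply: filter_from_proper.
    apply: filter_from_filter; first by exists 1; rewrite /=.
    move=> i j /= i0 j0; exists (Num.min i j); first by rewrite lt_min i0.
    by move=> x [Ax]; rewrite -ltrBlDl lt_min => /andP[xi xj];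
      split; split=> //; rewrite -ltrBlDl.
  move=> e /= e0.
  have [_ [x Ax <-] xe] := inf_adherent e0 Ainf.
  by exists x; split.
have Fex (P Q : set H) : F P -> F Q -> exists x, P x /\ Q x.
  by move=> FP FQ; exact: (@filter_ex _ F FF _ (@filterI _ F _ _ _ FP FQ)).
have Fcauchy : cauchy F.
  apply/cauchy_exP => e e0.
  pose r := complex.Re e.
  have rE : r%:C%C = e by rewrite RRe_real// gtr0_real.
  have r0 : 0 < r by rewrite -ltcR rE.
  have e'0 : 0 < r ^+ 2 / 5 by rewrite divr_gt0// exprn_gt0.
  have /filter_ex[x Bx] : F (B (r ^+ 2 / 5)) by exists (r ^+ 2 / 5).
  exists x; exists (r ^+ 2 / 5) => // y By; rewrite -ball_normE/=.
  rewrite -ltr_sqr ?nnegrE ?(ltW e0)// -nsqE -rE -rmorphXn/= ltcR.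
  by have := Bcv _ _ _ Bx By; lra.
have /cvg_ex[z Fz'] : cvg F by exact: cauchy_cvg.
have Fz : id @ F --> z by exact: Fz'.
have fM' x : `|f x| <= `|M| * `|x|.
  have [->|x1] := eqVneq x 0; first by rewrite f00 !normr0 mulr0.
  have M0 : 0 <= M * `|x| by apply: le_trans (fM x).
  by rewrite (@ger0_norm _ M)// -(pmulr_lge0 _ (_ : 0 < `|x|))// normr_gt0.
have fz : f z = 1.
  apply/eqP; rewrite -subr_eq0 -normr_eq0; apply: contraT => fz1.
  have fz0 : 0 < `|f z - 1| by rewrite lt_def fz1 normr_ge0.
  have M1 : 0 < `|M| + 1 by rewrite ltr_wpDl.
  have e0 : 0 < `|f z - 1| / (`|M| + 1) by rewrite divr_gt0.
  have /cvgrPdist_lt/(_ _ e0) Fz1 := Fz.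
  have FA : F A by exists 1 => //= x [].
  have [x [/= xz fx]] := Fex _ _ Fz1 FA.
  have := fM' (z - x); rewrite fB fx => h.
  suff : `|f z - 1| < `|f z - 1| by rewrite ltxx.
  apply: le_lt_trans h _; rewrite ltr_pdivlMr// in xz.
  apply: le_lt_trans xz; rewrite mulrC ler_wpM2l// lerDl//.
have nz : nsq z <= d.
  rewrite leNgt; apply/negP => dz.
  have d0 : 0 <= d by apply: lb_le_inf => [|_ [x _ <-]]; [exact: Ainf.1|].
  pose u := sqrtC (((d + nsq z) / 2)%:C%C : R[i]).
  have u0 : 0 <= u by rewrite sqrtC_ge0 (lecR 0) divr_ge0// addr_ge0.
  have uz : u < `|z|.
    rewrite -ltr_sqr ?nnegrE// sqrtCK -nsqE ltcR; lra.
  have Fu : F [set x | u < `|x|] by exact: (@cvgr_norm_gt _ _ _ F _ id z Fz u uz).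
  have FB : F (B ((nsq z - d) / 2)).
    by exists ((nsq z - d) / 2) => //=; rewrite divr_gt0// subr_gt0.
  have [x [/= ux [_ xd]]] := Fex _ _ Fu FB.
  move: ux; rewrite -ltr_sqr ?nnegrE// sqrtCK -nsqE ltcR; lra.
have zperp h : f h = 0 -> inner h z = 0.
  move=> fh; have [->|h0] := eqVneq h 0; first by rewrite linear0l.
  have hh0 : inner h h != 0 by rewrite dnorm_eq0.
  pose a := inner z h / inner h h.
  have wh : inner (z - a *: h) h = 0.
    by rewrite linearBl/= linearZl_LR/= divfK// subrr.
  have Aw : A (z - a *: h) by rewrite /A/= fB fZ fh mulr0 subr0.
  have := le_trans nz (dA _ Aw); rewrite -lecR !nsqE !norm_inner.
  rewrite [in leRHS]linearBr/= linearZr_LR/= wh mulr0 subr0 linearBl/=.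
  rewrite linearZl_LR/= (innerC h z) lerBrDr -lerBrDl subrr /a mulrAC -normCK.
  rewrite pmulr_lle0 ?invr_gt0 ?dnorm_gt0// => zh.
  have : `|inner z h| ^+ 2 == 0 by rewrite eq_le zh exprn_ge0.
  by rewrite expf_eq0/= normr_eq0 => /eqP ->; rewrite conjC0.
have z0 : `|z| ^+ 2 != 0.
  rewrite expf_eq0/= normr_eq0; apply/negP => /eqP z0.
  by move: fz; rewrite z0 f00 => /esym/eqP; rewrite oner_eq0.
exists ((`|z| ^+ 2)^-1 *: z) => x.
have /zperp : f (x - f x *: z) = 0 by rewrite fB fZ fz mulr1 subrr.
rewrite linearBl/= linearZl_LR/= -norm_inner => /eqP; rewrite subr_eq0 => /eqP h.
have zc : Num.conj (`|z| ^+ 2)^-1 = (`|z| ^+ 2)^-1.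
  by rewrite geC0_conj// invr_ge0 exprn_ge0.
by rewrite linearZr_LR/= zc h mulrCA mulVf// mulr1.
Qed.

End Riesz.

Section Adjoint.
Context (R : realType) (H K : hilbertType R).

Lemma adjoint_exists (T : bop H K) :
  exists S : bop K H, forall x y, inner (T x) y = inner x (S y).
Proof.
have [M M0 TM] := bop_ge0_bounded T.
have rep y : exists z, forall x, inner (T x) y = inner x z.
  apply: (@riesz_representation _ _ (fun x => inner (T x) y) (M * `|y|)).
    by move=> a u v; rewrite linearP linearPl.
  move=> x; rewrite (le_trans (inner_norm_le _ _))// mulrAC.
  by rewrite ler_wpM2r.
have [g gP] := choice rep.
have glin : linear g.
  move=> a u v; apply: inner_inj => x; rewrite -gP linearPr/= !gP.
  by rewrite -linearPr.
have gb : exists N : R[i], forall y, `|g y| <= N * `|y|.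
  exists M => y; have [->|gy0] := eqVneq (g y) 0.
    by rewrite normr0 mulr_ge0.
  have gy : 0 < `|g y| by rewrite normr_gt0.
  rewrite -(ler_pM2l gy) -expr2 norm_inner -gP.
  rewrite -[leLHS]ger0_norm; last by rewrite gP; exact: dnorm_ge0.
  rewrite (le_trans (inner_norm_le _ _))// mulrA ler_wpM2r// mulrC.
  exact: TM.
by exists (Bop glin gb) => x y; rewrite gP.
Qed.

Definition adj (T : bop H K) : bop K H := sval (cid (adjoint_exists T)).

Lemma adjP (T : bop H K) x y : inner (T x) y = inner x (adj T y).
Proof. exact: (svalP (cid (adjoint_exists T))). Qed.

Definition op_range (T : bop H K) : set K := range T.
Definition op_kernel (T : bop H K) : set H := T @^-1` [set 0].

End Adjoint.

Section BlockOperator.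
Context (R : realType) (H1 H2 K1 K2 : hilbertType R).
Variables (A : bop H1 K1) (B : bop H2 K1) (C : bop H1 K2) (D : bop H2 K2).

Let block_fun (z : hsum H1 H2) : hsum K1 K2 :=
  (A z.1 + B z.2, C z.1 + D z.2).

Let block_linear : linear block_fun.
Proof.
move=> a z w; rewrite /block_fun /= !linearP.
by congr pair; rewrite /= scalerDr addrACA.
Qed.

Let block_bounded : exists M : R[i], forall z, `|block_fun z| <= M * `|z|.
Proof.
have [a a0 Aa] := bop_ge0_bounded A; have [b b0 Bb] := bop_ge0_bounded B.
have [c c0 Cc] := bop_ge0_bounded C; have [d d0 Dd] := bop_ge0_bounded D.
exists ((a + b) + (c + d)) => z; rewrite !hsum_normE.
have z1 := hsum_norm_le1 z; have z2 := hsum_norm_le2 z.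
rewrite (le_trans (hsum_norm_le _))//= mulrDl lerD//.
- rewrite (le_trans (ler_normD _ _))// mulrDl lerD//.
    by rewrite (le_trans (Aa _))// ler_wpM2l.
  by rewrite (le_trans (Bb _))// ler_wpM2l.
- rewrite (le_trans (ler_normD _ _))// mulrDl lerD//.
    by rewrite (le_trans (Cc _))// ler_wpM2l.
  by rewrite (le_trans (Dd _))// ler_wpM2l.
Qed.

(* The operator given by the matrix with rows (A, B) and (C, D). *)
Definition block_op : bop (hsum H1 H2) (hsum K1 K2) :=
  Bop block_linear block_bounded.

End BlockOperator.

Section Drazin.
Context (A : pzRingType).
Implicit Types T Td : A.

Definition commutator (X Y : A) : A := X * Y - Y * X.

Definition drazin_eqs (p : nat) T Td : Prop :=
  [/\ commutator Td T = 0, Td ^+ 2 * T = Td & T ^+ p.+1 * Td = T ^+ p].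

Definition is_drazin_inverse T Td : Prop :=
  exists2 p, (1 <= p)%N & drazin_eqs p T Td.

(* The index is at least 1 by convention: an invertible T has index 1. *)
Definition drazin_index T (p : nat) : Prop :=
  [/\ (1 <= p)%N, exists Td, drazin_eqs p T Td &
      forall k, (1 <= k)%N -> (exists Td, drazin_eqs k T Td) -> (p <= k)%N].

Lemma drazin_eqs_le p k T Td :
  (p <= k)%N -> drazin_eqs p T Td -> drazin_eqs k T Td.
Proof.
move=> /subnK <- [cT T2 Tp]; split=> //.
by rewrite -addnS !exprD -mulrA Tp.
Qed.

Lemma is_drazin_inverse_unique T Td Td' :
  is_drazin_inverse T Td -> is_drazin_inverse T Td' -> Td = Td'.
Proof.
move=> [p _ H] [p' _ H']; set k := (p + p')%N.
have /(drazin_eqs_le (leq_addr p' p)) [/subr0_eq c T2 Tk] := H.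
have /(drazin_eqs_le (leq_addl p p')) [/subr0_eq c' T2' Tk'] := H'.
have sq X : X ^+ 2 * T = X -> forall j, X = X ^+ j.+1 * T ^+ j.
  move=> X2; elim=> [|j IH]; first by rewrite expr1 expr0 mulr1.
  rewrite [LHS]IH [T ^+ j.+1]exprS [in RHS]mulrA; congr (_ * _).
  by rewrite -(addn2 j) exprD -[RHS]mulrA X2 exprSr.
have com X : X * T = T * X -> forall i j, X ^+ i * T ^+ j = T ^+ j * X ^+ i.
  by move=> XT i j; apply/commrX/commr_sym/commrX/commr_sym.
have eTd : Td = Td * T * Td'.
  rewrite [LHS](sq _ T2 k) -Tk' [T ^+ k.+1]exprSr !mulrA.
  by rewrite -(sq _ T2 k).
have eTd' : Td' = Td * T * Td'.
  rewrite [LHS](sq _ T2' k) (com _ c') -{1}Tk -(com _ c 1%N) expr1 exprS.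
  by rewrite -!mulrA -(com _ c') -(sq _ T2' k).
by rewrite eTd -eTd'.
Qed.

End Drazin.

Section DN.
Context (R : realType) (H : hilbertType R).

(* The Drazin inverse is unique (is_drazin_inverse_unique), so the existential
   denotes the operator T_d of the class [(n,m)DN]. *)
Definition DN (n m : nat) (T : bop H H) : Prop :=
  exists2 Td : bop H H, is_drazin_inverse T Td &
    commutator (Td ^+ n) (adj T ^+ m) = 0.

Definition infinite_dimensional : Prop :=
  ~ exists s : seq H, forall x : H, exists c : 'I_(size s) -> R[i],
      x = \sum_(i < size s) c i *: s`_i.

End DN.
Arguments infinite_dimensional {R} H.

(* Main.v *)
(** The hypotheses on C amount to C S^q = 0 and T^p C = 0, whence
    T_d C = 0 = C S_d, so the direct sum of T_d and S_d is the Drazin inverse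
    of A.  Since T_d^m lies in the double commutant of T^m, the relation
    [T_d^n, T*^m] = 0 forces T_d^(mn) to be normal; a normal operator and its
    adjoint have the same kernel, so T_d and T_d* have the same kernel, and
    likewise S_d and S_d*.  The off-diagonal entry X of A^m satisfies
    T_d X = 0 and X S_d = 0, hence T_d* X = 0 and S_d X* = 0, which makes the
    off-diagonal entries in [A_d^n, A*^m] vanish. *)

Require Import Defs.
From mathcomp Require Import all_boot all_order all_algebra.
From mathcomp Require Import zify.
From mathcomp Require Import boolp classical_sets reals topology normedtype.

Import GRing.Theory Num.Theory.

Local Open Scope classical_set_scope.
Local Open Scope ring_scope.

Section DrazinRing.
Context {A : pzRingType}.
Implicit Types T Td X Y : A.

Lemma commutator_eq0 X Y : commutator X Y = 0 <-> GRing.comm X Y.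
Proof. by rewrite /commutator; split=> [/subr0_eq|->]; rewrite ?subrr. Qed.

(** [is_drazin_inverse] hides its exponent; uniqueness of the inverse allows it to be replaced by
    the index. *)
Lemma drazin_eqs_index p T Td :
  is_drazin_inverse T Td -> (1 <= p)%N -> (exists Td', drazin_eqs p T Td') ->
  drazin_eqs p T Td.
Proof.
move=> TTd p1 [Td' H].
suff -> : Td = Td' by [].
by apply: is_drazin_inverse_unique TTd _; exists p.
Qed.

(** Iterates [Td ^+ 2 * T = Td], so that [Td] factors through arbitrarily high powers of [T] and
    [Td]. *)
Lemma drazin_inverse_expD {p T Td} :
  drazin_eqs p T Td -> forall j, Td ^+ j.+1 * T ^+ j = Td.
Proof.
move=> [_ T2 _]; elim=> [|j IH]; first by rewrite expr0 mulr1.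
rewrite [T ^+ j.+1]exprS mulrA -(addn2 j) exprD -(mulrA _ (Td ^+ 2) T) T2.
by rewrite -exprSr.
Qed.

Lemma drazin_exp_absorb {p T Td} :
  drazin_eqs p T Td -> forall j, T ^+ (p + j) * Td ^+ j = T ^+ p.
Proof.
move=> H; elim=> [|j IH]; first by rewrite addn0 expr0 mulr1.
have [_ _ Tk] := drazin_eqs_le (leq_addr j p) H.
by rewrite addnS [Td ^+ _]exprS mulrA Tk.
Qed.

Lemma drazin_eqsX {p m T Td} :
  (1 <= m)%N -> drazin_eqs p T Td -> drazin_eqs p (T ^+ m) (Td ^+ m).
Proof.
move=> m1 H; have [/commutator_eq0 c T2 _] := H.
have pmp : (p <= p * m)%N by rewrite leq_pmulr.
split.
- by apply/commutator_eq0/commrX/commr_sym/commrX/commr_sym.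
- rewrite -exprM mulnC exprM -exprMn_comm ?T2//.
  exact/commr_sym/commrX/commr_sym.
- rewrite -!exprM mulnS addnC [(m * p)%N]mulnC.
  exact: drazin_exp_absorb (drazin_eqs_le pmp H) m.
Qed.

(* Both Td X and X Td equal Td T X Td. *)
Lemma drazin_double_commutant {p T Td X} :
  drazin_eqs p T Td -> GRing.comm X T -> GRing.comm X Td.
Proof.
move=> H XT; have [/commutator_eq0 c _ Tp] := H.
have XTp : X * T ^+ p = T ^+ p * X by exact: commrX.
have TdE : Td = Td ^+ p.+1 * T ^+ p by rewrite (drazin_inverse_expD H).
have TdE' : Td = T ^+ p * Td ^+ p.+1.
  by rewrite {1}TdE; exact/commrX/commr_sym/commrX/commr_sym.
rewrite /GRing.comm.
transitivity (Td * T * X * Td).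
  have Tp' : T ^+ p = Td * T * T ^+ p.
    rewrite -mulrA -exprS -{1}Tp.
    exact/commr_sym/commrX.
  (* [T ^+ p] is split off [Td], moved left across [X], made to emit the factor [Td * T], then moved
     back. *)
  by rewrite {1}TdE' mulrA XTp {1}Tp' -!mulrA (mulrA _ X) -XTp -mulrA -TdE'.
symmetry; rewrite {1}TdE -mulrA -XTp -{1}Tp [T ^+ _]exprSr.
by rewrite !mulrA -(mulrA _ X) XTp mulrA -TdE -(mulrA Td X) XT !mulrA.
Qed.

Lemma drazin_mul_eq0 {p T Td Y} :
  drazin_eqs p T Td -> T ^+ p * Y = 0 -> Td * Y = 0.
Proof.
by move=> H TY; rewrite -(drazin_inverse_expD H p) -mulrA TY mulr0.
Qed.

Lemma drazin_mul0_eq {p T Td Y} :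
  drazin_eqs p T Td -> Y * T ^+ p = 0 -> Y * Td = 0.
Proof.
move=> H YT; have [/commutator_eq0 c _ _] := H.
rewrite -(drazin_inverse_expD H p) (commrX _ (commr_sym (commrX _ _)))//.
by rewrite mulrA YT mul0r.
Qed.

End DrazinRing.

Section Adjoint.
Context {R : realType} {H : hilbertType R}.
Implicit Types S T N Y : bop H H.

Lemma adj_unique {K : hilbertType R} (T U : bop K K) :
  (forall x y, inner (T x) y = inner x (U y)) -> adj T = U.
Proof.
by move=> TU; apply: bop_ext => y; apply: inner_inj => x; rewrite -adjP TU.
Qed.

Lemma adjK T : adj (adj T) = T.
Proof. by apply: adj_unique => x y; rewrite innerC -adjP -innerC. Qed.

Lemma adj0 : adj (0 : bop H H) = 0.
Proof. by apply: adj_unique => x y; rewrite linear0l linear0r. Qed.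

Lemma adjM S T : adj (S * T) = adj T * adj S.
Proof. by apply: adj_unique => x y; rewrite -[(S * T) x]/(S (T x)) !adjP. Qed.

Lemma adjX T k : adj (T ^+ k) = adj T ^+ k.
Proof.
elim: k => [|k IH]; first exact: adj_unique.
by rewrite exprS adjM IH exprSr.
Qed.

(* ||N* y||^2 = <N N* y, y> = <N* N y, y>. *)
Lemma normal_adj_mul_eq0 N Y :
  GRing.comm N (adj N) -> N * Y = 0 -> adj N * Y = 0.
Proof.
move=> NN NY; apply: bop_ext => x; apply/eqP.
rewrite -normr_eq0 -sqrf_eq0 norm_inner.
rewrite -[(adj N * Y) x in X in inner _ X]/(adj N (Y x)) -adjP.
rewrite -[N _]/((N * (adj N * Y)) x) mulrA NN -mulrA NY mulr0.
by rewrite linear0l.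
Qed.

(** Taking adjoints, [adj (Td ^+ n)] commutes with [T ^+ m], hence with its Drazin inverse
    [Td ^+ m]; suitable powers of both sides give the exponent [m * n]. *)
Lemma drazin_exp_normal {p n m T Td} :
  drazin_eqs p T Td -> (1 <= m)%N -> GRing.comm (Td ^+ n) (adj T ^+ m) ->
  GRing.comm (Td ^+ (m * n)) (adj (Td ^+ (m * n))).
Proof.
move=> TTd m1 c.
have {}c : GRing.comm (adj (Td ^+ n)) (T ^+ m).
  by rewrite /GRing.comm -[T ^+ m]adjK -!adjM adjX -c.
have {}c := drazin_double_commutant (drazin_eqsX m1 TTd) c.
rewrite {2}mulnC !exprM (adjX (Td ^+ n)).
exact/commrX/commr_sym/commrX.
Qed.

(** With [N = Td ^+ (m * n)] normal, [N] and [adj N] annihilate the same [Y]. Each of [Td] and [N]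
    is a left multiple of the other, and so are their adjoints. *)
Lemma drazin_adj_mul_eq0 {p n m T Td Y} :
  drazin_eqs p T Td -> (1 <= n)%N -> (1 <= m)%N ->
  GRing.comm (Td ^+ n) (adj T ^+ m) -> Td * Y = 0 <-> adj Td * Y = 0.
Proof.
move=> TTd n1 m1 c; have := drazin_exp_normal TTd m1 c.
have : (0 < m * n)%N by rewrite muln_gt0 m1.
case: (m * n)%N => // k _ N_normal.
have [/commutator_eq0 cTd _ _] := TTd.
have TdE := drazin_inverse_expD TTd k.
have TdE' : T ^+ k * Td ^+ k.+1 = Td.
  by rewrite -[RHS]TdE; exact/commrX/commr_sym/commrX/commr_sym.
split=> TdY.
  have NY : Td ^+ k.+1 * Y = 0 by rewrite exprSr -mulrA TdY mulr0.
  by rewrite -TdE adjM -mulrA (normal_adj_mul_eq0 _ _ N_normal NY) mulr0.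
have NY : adj (Td ^+ k.+1) * Y = 0 by rewrite adjX exprSr -mulrA TdY mulr0.
rewrite -TdE' -mulrA -(adjK (Td ^+ _)) normal_adj_mul_eq0 ?mulr0//.
by rewrite adjK; exact: commr_sym.
Qed.

Lemma adj_block (A B C D : bop H H) :
  adj (block_op A B C D) = block_op (adj A) (adj C) (adj B) (adj D).
Proof.
apply: adj_unique => x y.
rewrite -[inner _ _]/(inner (A x.1 + B x.2) y.1 + inner (C x.1 + D x.2) y.2).
rewrite -[RHS]/(inner x.1 (adj A y.1 + adj C y.2) +
  inner x.2 (adj B y.1 + adj D y.2)).
by rewrite !linearDl/= !linearDr/= !adjP addrACA.
Qed.

Lemma block_mul (A B C D A' B' C' D' : bop H H) :
  block_op A B C D * block_op A' B' C' D' =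
  block_op (A * A' + B * C') (A * B' + B * D')
           (C * A' + D * C') (C * B' + D * D').
Proof.
by apply: bop_ext => x; congr pair; rewrite /= !linearD/= addrACA.
Qed.

(** The corner sums the words of length [k] with exactly one letter [C]. For [k = 0] the sum is
    empty, so the truncated [k.-1] is harmless. *)
Lemma block_expr T (C : bop H H) S k :
  block_op T C 0 S ^+ k =
  block_op (T ^+ k) (\sum_(i < k) T ^+ (k.-1 - i) * C * S ^+ i) 0 (S ^+ k).
Proof.
elim: k => [|k IH].
  rewrite big_ord0; apply: bop_ext => -[x y].
  by congr pair; rewrite /= ?addr0 ?add0r.
rewrite exprS IH block_mul !mulr0 !mul0r !addr0 add0r -!exprS.
congr (block_op _ _ _ _); rewrite big_ord_recr/= subnn expr0 mul1r.
congr (_ + _); rewrite mulr_sumr; apply: eq_bigr => i _.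
rewrite !mulrA -exprS; congr (_ ^+ _ * _ * _).
by have := ltn_ord i; lia.
Qed.

Lemma drazin_block p q (T C S Td Sd : bop H H) :
  drazin_eqs p T Td -> drazin_eqs q S Sd -> T ^+ p * C = 0 -> C * S ^+ q = 0 ->
  drazin_eqs (p + q) (block_op T C 0 S) (block_op Td 0 0 Sd).
Proof.
move=> TTd SSd TC CS.
have TdC := drazin_mul_eq0 TTd TC; have CSd := drazin_mul0_eq SSd CS.
have [/commutator_eq0 cT T2 _] := TTd; have [/commutator_eq0 cS S2 _] := SSd.
have [_ _ Tk] := drazin_eqs_le (leq_addr q p) TTd.
have [_ _ Sk] := drazin_eqs_le (leq_addl p q) SSd.
(* Either [i >= q] and [C * S ^+ i] vanishes, or [i <= q - 1] and the exponent [k.-1 - i] is at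
   least [p]. *)
have offdiag0 k : (p + q <= k)%N ->
    \sum_(i < k) T ^+ (k.-1 - i) * C * S ^+ i = 0.
  move=> pqk; apply: big1 => i _; have [qi|iq] := leqP q i.
    by rewrite -(subnKC qi) exprD -mulrA (mulrA C) CS mul0r mulr0.
  have pki : (p <= k.-1 - i)%N by have := ltn_ord i; lia.
  by rewrite -(subnK pki) exprD -(mulrA _ _ C) TC mulr0 mul0r.
split.
- by apply/commutator_eq0; rewrite /GRing.comm !block_mul TdC CSd cT cS
    !mulr0 !mul0r !addr0.
- by rewrite expr2 -mulrA !block_mul !(mulr0, mul0r, addr0, add0r) TdC !mulr0
    !mulrA -!expr2 T2 S2.
- by rewrite !block_expr !offdiag0// block_mul
    !(mulr0, mul0r, addr0, add0r) Tk Sk.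
Qed.

End Adjoint.

Theorem theorem2p13 (R : realType) (H : hilbertType R)
  (H_infinite : infinite_dimensional H)
  (n m : nat) (n_ge1 : (1 <= n)%N) (m_ge1 : (1 <= m)%N)
  (S T : bop H H) (S_DN : DN n m S) (T_DN : DN n m T)
  (q p : nat) (S_index : drazin_index S q) (T_index : drazin_index T p)
  (C : bop H H)
  (C_range : op_range (S ^+ q) `<=` op_kernel C)
  (C_kernel : C @` op_kernel (S ^+ q) `<=` op_kernel (T ^+ p)) :
  DN n m (block_op T C 0 S).
Proof.
have [Sd /drazin_eqs_index SSd /commutator_eq0 cS] := S_DN.
have [Td /drazin_eqs_index TTd /commutator_eq0 cT] := T_DN.
have {SSd} SSd : drazin_eqs q S Sd by case: S_index => *; exact: SSd.
have {TTd} TTd : drazin_eqs p T Td by case: T_index => *; exact: TTd.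
have CS : C * S ^+ q = 0.
  by apply: bop_ext => x; apply: (C_range); exists x.
have TC : T ^+ p * C = 0.
  (* [E] projects onto the range of [S ^+ q] along its kernel, so [C] kills [E] and only the kernel
     part [1 - E] remains. *)
  pose E := S ^+ q * Sd ^+ q.
  have CE : C * (1 - E) = C by rewrite mulrBr mulr1 /E mulrA CS mul0r subr0.
  have SE : S ^+ q * (1 - E) = 0.
    by rewrite mulrBr mulr1 /E mulrA -exprD (drazin_exp_absorb SSd) subrr.
  rewrite -CE; apply: bop_ext => x; apply: (C_kernel).
  exists ((1 - E) x) => //.
  by rewrite /op_kernel/= -[LHS]/((S ^+ q * (1 - E)) x) SE.
have TdC := drazin_mul_eq0 TTd TC; have CSd := drazin_mul0_eq SSd CS.
exists (block_op Td 0 0 Sd).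
  exists (p + q)%N; last exact: drazin_block.
  by case: T_index => p1 _ _; rewrite (leq_trans p1)// leq_addr.
rewrite -adjX !block_expr adj_block big1; last first.
  by move=> i _; rewrite mulr0 mul0r.
set X := \sum_(i < m) _; rewrite !adj0 !adjX.
have [[/commutator_eq0 cTd _ _] [/commutator_eq0 cSd _ _]] := (TTd, SSd).
have TdX : Td * X = 0.
  rewrite mulr_sumr big1// => i _.
  by rewrite !mulrA (commrX _ cTd) -(mulrA _ Td) TdC mulr0 mul0r.
have XSd : X * Sd = 0.
  rewrite mulr_suml big1// => i _.
  by rewrite -!mulrA -(commrX _ cSd) (mulrA C) CSd mul0r mulr0.
(* The kernel equivalence is used forwards for [T] here and backwards for [S] below. *)
have XTd : adj X * Td = 0.
  rewrite -(adjK Td) -adjM.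
  by rewrite ((drazin_adj_mul_eq0 TTd n_ge1 m_ge1 cT).1 TdX) adj0.
have SdX : Sd * adj X = 0.
  apply/(drazin_adj_mul_eq0 SSd n_ge1 m_ge1 cS).
  by rewrite -adjM XSd adj0.
(* Off the diagonal only [Sd ^+ n * adj X] and [adj X * Td ^+ n] survive; [n >= 1] exposes a factor
   [Sd] or [Td] next to [adj X]. *)
apply/commutator_eq0; rewrite /GRing.comm !block_mul.
rewrite !(mulr0, mul0r, addr0, add0r) cT cS.
have -> : adj X * Td ^+ n = 0.
  by rewrite -(prednK n_ge1) exprS mulrA XTd mul0r.
by rewrite -[in Sd ^+ n](prednK n_ge1) exprSr -mulrA SdX mulr0.
Qed.
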